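(* Let $V$ be a smooth CLF on $\mathbb{X}$ for the system $\dot x=f(x)+g(x)u$ with inputs in $\mathbb{U}(\theta)$. Suppose that for some $\sigma>0$ and for all $x\in\mathbb{X}$, $$\exists\,u\in\mathbb{U}(\theta):\quad L_fV(x)+L_gV(x)u\le-\sigma V(x).$$ Assume there exist $c_0\in(0,c_{\max}]$ and $\sigma_0>0$ such that for all $x\in\Omega(V,c_0)$, $$\exists\,u\in\mathbb{U}(\theta):\quad L_fV(x)+L_gV(x)u\le-(\sigma+\sigma_0)V(x).$$ Then there exists $\alpha_{cave}\in\mathcal{K}_{cave}$ such that for all $x\in\mathbb{X}$, $$\exists\,u\in\mathbb{U}(\theta):\quad L_fV(x)+L_gV(x)u\le-\alpha_{cave}(V(x)),$$ and for every $c\in(0,c_{\max}]$ there exists $\epsilon_0\in(0,\min\{c,c_0\})$ such that for all $\epsilon\in(0,\epsilon_0)$, $$\sigma_{\alpha_{cave}}(\epsilon,c)>\sigma.$$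
   Context: The system is $\dot x=f(x)+g(x)u$ with $x\in\mathbb{X}\subset\mathbb{R}^n$, $f:\mathbb{X}\to\mathbb{R}^n$ and $g:\mathbb{X}\to\mathbb{R}^{n\times m}$ locally Lipschitz, $f(0)=0$, $g(0)\neq0$, and inputs in $\mathbb{U}(\theta)=\{u\in\mathbb{R}^m:\|u\|_\infty\le\theta\}$, $\theta>0$. The set $\mathbb{X}$ is compact, contains the origin and is control-invariant with respect to $\mathbb{U}(\theta)$: for every $x_0\in\mathbb{X}$ there is a measurable, essentially bounded input $u(\cdot)$ with values in $\mathbb{U}(\theta)$ such that the Carathéodory solution starting at $x_0$ remains in $\mathbb{X}$ for all $t\ge0$. Lie derivatives: $L_fV=\nabla V^\top f$, $L_gV=\nabla V^\top g$. A function $\alpha:[0,a)\to[0,\infty)$ (with $0<a\le\infty$) is of class $\mathcal{K}$ if it is continuous, strictly increasing and $\alpha(0)=0$; $\mathcal{K}_{cave}$ is the set of strictly concave class-$\mathcal{K}$ functions (here with domain large enough for all evaluations to make sense). A smooth, positive-definite $V:\mathbb{R}^n\to\mathbb{R}_{\ge0}$ is a control Lyapunov function (CLF) on $\mathbb{X}$ with inputs in $\mathbb{U}(\theta)$ if there exist $0<k_1\le k_2$ and $\alpha\in\mathcal{K}$ such that for all $x\in\mathbb{X}$: $k_1\|x\|^2\le V(x)\le k_2\|x\|^2$ and $\inf_{u\in\mathbb{U}(\theta)}\{L_fV(x)+L_gV(x)u+\alpha(V(x))\}\le0$. Sublevel sets: $\Omega(V,c)=\{x:V(x)\le c\}$ and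 $c_{\max}=\sup\{v:\Omega(V,v)\subseteq\mathbb{X}\}$. For $\alpha\in\mathcal{K}$ and $0<\epsilon<c$: $T_\alpha(\epsilon,c)=\int_\epsilon^c\frac{1}{\alpha(y)}\,dy$ and $\sigma_\alpha(\epsilon,c)=\frac{\ln(c/\epsilon)}{T_\alpha(\epsilon,c)}$ (windowed nominal rate). *)

(* Defs.v *)
From HB Require Import structures.
From mathcomp Require Import all_boot all_order all_algebra.
From mathcomp Require Import all_classical all_reals all_analysis.

Set Implicit Arguments.
Unset Strict Implicit.
Unset Printing Implicit Defensive.

Import Order.TTheory GRing.Theory Num.Theory.
Import numFieldNormedType.Exports.

Local Open Scope classical_set_scope.
Local Open Scope ring_scope.

(* R^n is ['cV[R]_n].  The library norm [`|x|] on matrices is the sup norm; it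
   serves for |u|_oo and, all norms being equivalent, for topology, Lipschitz
   continuity and absolute continuity.  [enorm] is the Euclidean norm.

   The vector fields f and g live on a set X only.  They are represented by
   total functions whose values outside X are arbitrary, so every condition
   below evaluates them at points of X only. *)

Section LieDerivatives.
Context {R : realType} {n m : nat}.
Implicit Types (V : 'cV[R]_n -> R) (f : 'cV[R]_n -> 'cV[R]_n)
  (g : 'cV[R]_n -> 'M[R]_(n, m)) (x : 'cV[R]_n).

Definition enorm x : R := Num.sqrt (\sum_i x i 0 ^+ 2).

Definition partial (i : 'I_n) V : 'cV[R]_n -> R :=
  fun x => 'D_(delta_mx i 0 : 'cV[R]_n) V x.

(* C^oo: partial derivatives of every order exist and are continuous. *)
Definition smooth V := forall s : seq 'I_n,
  continuous (foldr partial V s) /\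
  forall i x, derivable (foldr partial V s) x (delta_mx i 0 : 'cV[R]_n).

Definition positive_definite V := V 0 = 0 /\ forall x, x != 0 -> 0 < V x.

Definition grad V x : 'cV[R]_n := \col_i partial i V x.

Definition Lf f V x : R := ((grad V x)^T *m f x) 0 0.

Definition Lg g V x : 'rV[R]_m := (grad V x)^T *m g x.

(* L_f V(x) + L_g V(x) u *)
Definition lie f g V x (u : 'cV[R]_m) : R := Lf f V x + (Lg g V x *m u) 0 0.

End LieDerivatives.

Section ControlSystem.
Context {R : realType} {n m : nat}.
Implicit Types (X : set 'cV[R]_n) (f : 'cV[R]_n -> 'cV[R]_n)
  (g : 'cV[R]_n -> 'M[R]_(n, m)) (theta : R).

Definition inputs theta : set 'cV[R]_m := [set u | `|u| <= theta].

Definition abs_continuous (a b : R) (x : R -> 'cV[R]_n) :=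
  forall e : R, 0 < e -> exists2 d : R, 0 < d &
    forall (k : nat) (s t : 'I_k -> R),
      (forall i, a <= s i /\ s i <= t i /\ t i <= b) ->
      trivIset setT (fun i => `]s i, t i[%classic) ->
      \sum_i (t i - s i) < d -> \sum_i `|x (t i) - x (s i)| < e.

(* Both x and u are signals on [0, +oo[; their values at t < 0 are arbitrary. *)
Definition caratheodory_solution f g (u : R -> 'cV[R]_m) (x0 : 'cV[R]_n)
    (x : R -> 'cV[R]_n) :=
  [/\ x 0 = x0,
      forall T : R, 0 < T -> abs_continuous 0 T x &
      {ae (@lebesgue_measure R), forall t : R, 0 <= t ->
        is_derive t (1 : R) x (f (x t) + g (x t) *m u t)}].

(* Essential boundedness of u is implied by its values being in
   [inputs theta]. *)
Definition control_invariant f g theta X :=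
  forall x0, X x0 -> exists u : R -> 'cV[R]_m,
    [/\ forall i, measurable_fun (`[0, +oo[%classic : set R)
          (fun t : R => u t i 0),
        forall t : R, 0 <= t -> inputs theta (u t) &
        exists2 x : R -> 'cV[R]_n, caratheodory_solution f g u x0 x &
          forall t : R, 0 <= t -> X (x t)].

End ControlSystem.

Section ComparisonFunctions.
Context {R : realType}.
Implicit Types (a : \bar R) (alpha : R -> R).

(* The interval [0, a[, where a may be +oo. *)
Definition Kdom a : set R := [set y | 0 <= y /\ (y%:E < a)%E].

Definition class_K a alpha :=
  [/\ (0 < a)%E,
      {within Kdom a, continuous alpha},
      forall y z, Kdom a y -> Kdom a z -> y < z -> alpha y < alpha z &
      alpha 0 = 0].

Definition strictly_concave (D : set R) alpha :=
  forall y z t : R, D y -> D z -> y != z -> 0 < t -> t < 1 ->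
    t * alpha y + (1 - t) * alpha z < alpha (t * y + (1 - t) * z).

Definition class_Kcave a alpha :=
  class_K a alpha /\ strictly_concave (Kdom a) alpha.

Definition Tint alpha (eps c : R) : R :=
  \int[@lebesgue_measure R]_(y in `[eps, c]) (alpha y)^-1.

Definition nominal_rate alpha (eps c : R) : R := ln (c / eps) / Tint alpha eps c.

End ComparisonFunctions.

Section CLF.
Context {R : realType} {n m : nat}.
Implicit Types (X : set 'cV[R]_n) (V : 'cV[R]_n -> R).

Definition is_CLF (f : 'cV[R]_n -> 'cV[R]_n) (g : 'cV[R]_n -> 'M[R]_(n, m))
    (theta : R) X V :=
  [/\ smooth V, positive_definite V &
      exists (k1 k2 : R) (a : \bar R) (alpha : R -> R),
        [/\ 0 < k1, k1 <= k2, class_K a alpha &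
            forall x, X x ->
              [/\ k1 * enorm x ^+ 2 <= V x,
                  V x <= k2 * enorm x ^+ 2,
                  Kdom a (V x) &
                  inf [set lie f g V x u + alpha (V x) | u in inputs theta]
                    <= 0]]].

Definition Omega V (c : R) : set 'cV[R]_n := [set x | V x <= c].

Definition cmax X V : R := sup [set v : R | Omega V v `<=` X].

End CLF.

(* Main.v *)
Require Import Defs.
From mathcomp Require Import all_boot all_order all_algebra.
From mathcomp Require Import all_classical all_reals all_analysis.
From mathcomp Require Import ring lra.
Import Order.TTheory GRing.Theory Num.Theory.
Import numFieldNormedType.Exports.
Local Open Scope classical_set_scope.
Local Open Scope ring_scope.

(** The required decay rate must be at most (sigma + sigma0) y on [0, c0] and
    at most sigma y beyond c0.  The saturating function

      alpha(y) = p y / (1 + q y),  p = sigma + sigma0,  q = sigma0 / (sigma c0),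

    satisfies both: the ratio alpha(y) / y = p / (1 + q y) decreases from p,
    and q is the value for which it equals sigma exactly at c0.  It is strictly
    concave and strictly increasing on the whole half-line, so +oo can serve as
    the right end of its domain ([class_Kcave_saturating]).

    Its reciprocal is 1 / (p y) + q / p, hence

      T_alpha(eps, c) = (ln (c / eps) + q (c - eps)) / p

    ([Tint_saturating]).  The term ln (c / eps) dominates as eps -> 0, so the
    windowed rate tends to p > sigma.  With the above p and q, the rate exceeds
    sigma as soon as (c - eps) / c0 < ln (c / eps), which holds for all
    eps < c exp(- c / c0).  This threshold lies below both c and c0, the latter
    because t exp(- t) < 1 at t = c / c0. *)

Definition saturating {R : realType} (p q y : R) : R := p * y / (1 + q * y).

Lemma saturating_den_gt0 (R : realType) (q y : R) :
  0 <= q -> 0 <= y -> 0 < 1 + q * y.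
Proof. by move=> q0 y0; rewrite ltr_pwDl// mulr_ge0. Qed.

Lemma saturating_le_linear (R : realType) (p q y : R) :
  0 <= p -> 0 <= q -> 0 <= y -> saturating p q y <= p * y.
Proof.
move=> p0 q0 y0; rewrite /saturating ler_pdivrMr ?saturating_den_gt0//.
by rewrite ler_peMr ?mulr_ge0// lerDl mulr_ge0.
Qed.

(** The ratio of [saturating p q] to the identity decreases, so a linear bound
    valid at [z] (hypothesis [psz]) persists beyond [z]. *)
Lemma saturating_le_linear_after (R : realType) (p q s z y : R) :
  0 <= q -> 0 <= s -> 0 <= z -> p <= s * (1 + q * z) -> z <= y ->
  saturating p q y <= s * y.
Proof.
move=> q0 s0 z0 psz zy; have y0 : 0 <= y by apply: le_trans zy.
rewrite /saturating ler_pdivrMr ?saturating_den_gt0// -mulrA.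
rewrite (mulrC y) mulrA; apply: ler_wpM2r => //.
by apply: le_trans psz _; rewrite ler_wpM2l// lerD2l ler_wpM2l.
Qed.

Lemma continuous_saturating (R : realType) (p q y : R) :
  0 <= q -> 0 <= y -> {for y, continuous (saturating p q)}.
Proof.
move=> q0 y0; apply: cvgM; first by apply: cvgM; [exact: cvg_cst|exact: cvg_id].
apply: cvgV; first by rewrite gt_eqF// saturating_den_gt0.
by apply: cvgD; [exact: cvg_cst|apply: cvgM; [exact: cvg_cst|exact: cvg_id]].
Qed.

Lemma saturating_increasing (R : realType) (p q y z : R) :
  0 < p -> 0 <= q -> 0 <= y -> y < z -> saturating p q y < saturating p q z.
Proof.
move=> p0 q0 y0 yz; have z0 : 0 <= z by apply: le_trans (ltW yz).
have Dy := saturating_den_gt0 _ _ _ q0 y0.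
have Dz := saturating_den_gt0 _ _ _ q0 z0.
rewrite /saturating ltr_pdivrMr// mulrAC ltr_pdivlMr// -subr_gt0.
rewrite (_ : _ - _ = p * (z - y)); last by ring.
by rewrite mulr_gt0// subr_gt0.
Qed.

(** The concavity gap has a closed form, visibly positive off the diagonal. *)
Lemma saturating_strictly_concave (R : realType) (p q : R) :
  0 < p -> 0 < q -> strictly_concave [set y : R | 0 <= y] (saturating p q).
Proof.
move=> p0 q0 y z t /= y0 z0 yz t0 t1.
have u0 : 0 < 1 - t by rewrite subr_gt0.
have w0 : 0 <= t * y + (1 - t) * z by rewrite addr_ge0// mulr_ge0// ltW.
have Dy := saturating_den_gt0 _ _ _ (ltW q0) y0.
have Dz := saturating_den_gt0 _ _ _ (ltW q0) z0.
have Dw := saturating_den_gt0 _ _ _ (ltW q0) w0.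
rewrite -subr_gt0.
have -> : saturating p q (t * y + (1 - t) * z) -
    (t * saturating p q y + (1 - t) * saturating p q z) =
    p * q * t * (1 - t) * (y - z) ^+ 2 /
    ((1 + q * (t * y + (1 - t) * z)) * (1 + q * y) * (1 + q * z)).
  by rewrite /saturating; field; rewrite !gt_eqF.
have yz2 : 0 < (y - z) ^+ 2 by rewrite exprn_even_gt0//= subr_eq0.
by move: yz2; move: (_ ^+ 2) => d d0; apply: divr_gt0; rewrite !mulr_gt0.
Qed.

Lemma class_Kcave_saturating (R : realType) (p q : R) :
  0 < p -> 0 < q -> class_Kcave +oo%E (saturating p q).
Proof.
move=> p0 q0; split; [split|].
- by [].
- apply: continuous_in_subspaceT => y /set_mem [y0 _].
  exact: continuous_saturating (ltW q0) y0.
- by move=> y z [y0 _] _; exact: saturating_increasing (ltW q0) y0.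
- by rewrite /saturating mulr0 mul0r.
- by move=> y z t [y0 _] [z0 _]; exact: saturating_strictly_concave.
Qed.

(** The second fundamental theorem of calculus for a primitive that is
    differentiable up to the end points, which makes its one-sided continuity
    there automatic. *)
Lemma Rintegral_is_derive (R : realType) (f F : R -> R) (a b : R) : a < b ->
  (forall x, a <= x <= b -> {for x, continuous f}) ->
  (forall x, a <= x <= b -> is_derive x (1 : R) F (f x)) ->
  (\int[@lebesgue_measure R]_(x in `[a, b]) f x)%R = F b - F a.
Proof.
move=> ab cf dF.
have cF x : a <= x <= b -> {for x, continuous F}.
  by move=> /dF [dFx _]; exact/differentiable_continuous/derivable1_diffP.
rewrite /Rintegral (@continuous_FTC2 _ f F)//.
- by apply: continuous_in_subspaceT => x /set_mem /=; rewrite in_itv/=; exact: cf.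
- split.
  + by move=> x; rewrite in_itv/= => /andP[ax xb]; case: (dF x) => //; rewrite !ltW.
  + by apply: cvg_at_right_filter; apply: cF; rewrite lexx ltW.
  + by apply: cvg_at_left_filter; apply: cF; rewrite lexx ltW.
- move=> x; rewrite in_itv/= => /andP[ax xb]; rewrite derive1E.
  by case: (dF x) => //; rewrite !ltW.
Qed.

Lemma Tint_saturating (R : realType) (p q eps c : R) :
  0 < p -> 0 <= q -> 0 < eps -> eps < c ->
  Tint (saturating p q) eps c = (ln (c / eps) + q * (c - eps)) / p.
Proof.
move=> p0 q0 e0 ec; have c0 := lt_trans e0 ec.
pose F (y : R) := p^-1 * (ln y + q * y).
have cf x : eps <= x <= c -> {for x, continuous (fun y => (saturating p q y)^-1)}.
  move=> /andP[ex _]; have x0 := lt_le_trans e0 ex.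
  have D0 := saturating_den_gt0 _ _ _ q0 (ltW x0).
  apply: cvgV; last exact: continuous_saturating (ltW x0).
  by rewrite gt_eqF// divr_gt0 ?mulr_gt0.
have dF x : eps <= x <= c -> is_derive x (1 : R) F (saturating p q x)^-1.
  move=> /andP[ex _]; have x0 := lt_le_trans e0 ex.
  have D0 := saturating_den_gt0 _ _ _ q0 (ltW x0).
  have dln := is_derive1_ln x0.
  apply: is_derive_eq.
  by rewrite /saturating /GRing.scale/=; field; rewrite !gt_eqF.
rewrite /Tint (Rintegral_is_derive _ _ _ _ _ ec cf dF).
by rewrite /F ln_div ?posrE//; field; rewrite gt_eqF.
Qed.

Lemma nominal_rate_saturating_gt (R : realType) (p q s eps c : R) :
  0 < p -> 0 <= q -> 0 < eps -> eps < c ->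
  s * q * (c - eps) < (p - s) * ln (c / eps) ->
  s < nominal_rate (saturating p q) eps c.
Proof.
move=> p0 q0 e0 ec h.
have L0 : 0 < ln (c / eps) by rewrite ln_gt0// ltr_pdivlMr// mul1r.
have N0 : 0 < ln (c / eps) + q * (c - eps).
  by rewrite ltr_pwDl// mulr_ge0// subr_ge0 ltW.
rewrite /nominal_rate Tint_saturating// ltr_pdivlMr ?divr_gt0// mulrA.
rewrite ltr_pdivrMr//; lra.
Qed.

Lemma ln_div_gt_of_lt_expR (R : realType) (c c0 eps : R) :
  0 < c -> 0 < eps -> eps < c * expR (- (c / c0)) -> c / c0 < ln (c / eps).
Proof.
move=> cp e0; rewrite expRN ltr_pdivlMr ?expR_gt0// => h.
rewrite -ltr_expR lnK ?posrE ?divr_gt0// ltr_pdivlMr// mulrC//.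
Qed.

(** Dividing by [c0], the bound by [c0] is t exp(- t) < 1 for t = c / c0, which
    follows from 1 + t < exp t. *)
Lemma expR_threshold_lt_min (R : realType) (c c0 : R) :
  0 < c -> 0 < c0 -> 0 < c * expR (- (c / c0)) < Num.min c c0.
Proof.
move=> cp c0p; have t0 : 0 < c / c0 by rewrite divr_gt0.
have e1 := expR_gt1Dx (lt0r_neq0 t0).
rewrite mulr_gt0 ?expR_gt0//= lt_min expRN !ltr_pdivrMr ?expR_gt0//.
apply/andP; split; first by rewrite ltr_pMr//; lra.
by rewrite mulrC -ltr_pdivrMr//; lra.
Qed.

Theorem theorem2 (R : realType) (n m : nat)
  (X : set 'cV[R]_n) (f : 'cV[R]_n -> 'cV[R]_n) (g : 'cV[R]_n -> 'M[R]_(n, m))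
  (theta : R) (V : 'cV[R]_n -> R) (sigma : R)
  (theta_gt0 : 0 < theta)
  (X_compact : compact X) (X0 : X 0)
  (f_lip : [locally [lipschitz f x | x in X]])
  (g_lip : [locally [lipschitz g x | x in X]])
  (f0 : f 0 = 0) (g0 : g 0 <> 0)
  (X_inv : control_invariant f g theta X)
  (V_CLF : is_CLF f g theta X V)
  (sigma_gt0 : 0 < sigma)
  (V_decay : forall x, X x ->
     exists2 u, inputs theta u & lie f g V x u <= - (sigma * V x))
  (c0 sigma0 : R) (c0_gt0 : 0 < c0) (c0_le : c0 <= cmax X V)
  (sigma0_gt0 : 0 < sigma0)
  (V_decay0 : forall x, X x -> Omega V c0 x ->
     exists2 u, inputs theta u &
       lie f g V x u <= - ((sigma + sigma0) * V x)) :
  exists (a : \bar R) (alpha : R -> R),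
    [/\ class_Kcave a alpha,
        forall x, X x -> Kdom a (V x) /\
          exists2 u, inputs theta u & lie f g V x u <= - alpha (V x) &
        forall c : R, 0 < c -> c <= cmax X V -> Kdom a c /\
          exists2 eps0 : R, 0 < eps0 < Num.min c c0 &
            forall eps : R, 0 < eps < eps0 ->
              sigma < nominal_rate alpha eps c].
Proof.
have [_ [V0 Vpos] _] := V_CLF.
have V_ge0 x : 0 <= V x.
  by have [->|/Vpos/ltW//] := eqVneq x 0; rewrite V0.
pose p := sigma + sigma0; pose q := sigma0 / (sigma * c0).
have p0 : 0 < p by rewrite addr_gt0.
have q0 : 0 < q by rewrite divr_gt0 ?mulr_gt0.
have p_at_c0 : p = sigma * (1 + q * c0).
  by rewrite /p /q; field; rewrite !gt_eqF.
exists +oo%E, (saturating p q); split; first exact: class_Kcave_saturating.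
- move=> x Xx; split; first by split; [exact: V_ge0|exact: ltry].
  have [Vc0|/ltW c0V] := leP (V x) c0.
  + have [u Uu Hu] := V_decay0 x Xx Vc0; exists u => //.
    apply: le_trans Hu _; rewrite lerN2.
    exact: saturating_le_linear (ltW p0) (ltW q0) (V_ge0 x).
  + have [u Uu Hu] := V_decay x Xx; exists u => //.
    apply: le_trans Hu _; rewrite lerN2.
    apply: (@saturating_le_linear_after _ _ _ _ c0) => //; try exact: ltW.
    by rewrite -p_at_c0.
- move=> c cp _; split; first by split; [exact: ltW|exact: ltry].
  have thr := @expR_threshold_lt_min _ c c0 cp c0_gt0.
  exists (c * expR (- (c / c0))) => // eps /andP[eps0 eps_thr].
  have ec : eps < c.
    by apply: (lt_trans eps_thr); move: thr; rewrite lt_min => /and3P[].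
  apply: nominal_rate_saturating_gt => //; first exact: ltW.
  (* The choice of q makes both coefficients multiples of sigma0:
     sigma q = sigma0 / c0 and p - sigma = sigma0. *)
  have -> : sigma * q * (c - eps) = sigma0 * ((c - eps) / c0).
    by rewrite /q; field; rewrite !gt_eqF.
  have -> : p - sigma = sigma0 by rewrite /p addrC addKr.
  rewrite ltr_pM2l//; apply: le_lt_trans (@ln_div_gt_of_lt_expR _ c c0 eps cp eps0 eps_thr).
  by rewrite ler_pM2r ?invr_gt0// gerBl ltW.
Qed.
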